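(* The octo-algebra (i.e. the ABQR operad with the eight generating operations and 27 relations of an octo-algebra) is isomorphic to the third power of the dendriform dialgebra, that is, to the ABQR operad of type $$\big((\Omega_D,\Lambda_D)\,\square\,(\Omega_D,\Lambda_D)\big)\,\square\,(\Omega_D,\Lambda_D),$$ where $(\Omega_D,\Lambda_D)$ is the type of the dendriform dialgebra.
   Context: $\mathbf{k}$ is a field of characteristic zero. A binary, quadratic, regular operad is identified with its type: a pair $(\Omega,\Lambda)$ with $\Omega$ a finite-dimensional $\mathbf{k}$-vector space of binary operations and $\Lambda\subseteq\Omega^{\otimes 2}\oplus\Omega^{\otimes 2}$ a linear subspace; the element $\big(\sum_i a_i\otimes b_i,\ \sum_j c_j\otimes d_j\big)$ stands for the relation $\sum_i(x\,a_i\,y)\,b_i\,z=\sum_j x\,c_j\,(y\,d_j\,z)$. A structure given by finitely many operation symbols and such relations has type $(\Omega,\Lambda)$ with $\Omega$ having the symbols as basis and $\Lambda$ spanned by the relations. The operad is ABQR with associative operation $\star\in\Omega$ if $(\star\otimes\star,\star\otimes\star)\in\Lambda$. An isomorphism $(\Omega,\Lambda)\to(\Omega',\Lambda')$ of ABQR operads with associative operations $\star,\star'$ is a linear bijection $f:\Omega\to\Omega'$ with $f(\star)=\star'$ and $(f^{\otimes2}\oplus f^{\otimes2})(\Lambda)=\Lambda'$. Square product: write $\left[{\odot_1\atop\odot_2}\right]:=\odot_1\otimes\odot_2\in\Omega_1\otimes\Omega_2$. For $f_i=(a_i\otimes b_i,\ c_i\otimes d_i)$, $i=1,2$, put $\left[{f_1\atop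 f_2}\right]=\left(\left[{a_1\atop a_2}\right]\otimes\left[{b_1\atop b_2}\right],\ \left[{c_1\atop c_2}\right]\otimes\left[{d_1\atop d_2}\right]\right)$, extended bilinearly to $f_i\in\Omega_i^{\otimes2}\oplus\Omega_i^{\otimes2}$ (that is, $((u_1,v_1),(u_2,v_2))\mapsto(\sigma(u_1\otimes u_2),\sigma(v_1\otimes v_2))$, $\sigma$ exchanging the second and third tensor factors). $\Lambda_1\,\square\,\Lambda_2$ is the span of all $\left[{f_1\atop f_2}\right]$ with $f_1\in\Lambda_1,f_2\in\Lambda_2$, and $(\Omega_1,\Lambda_1)\,\square\,(\Omega_2,\Lambda_2)=(\Omega_1\otimes\Omega_2,\Lambda_1\,\square\,\Lambda_2)$, with associative operation $\left[{\star_1\atop\star_2}\right]$. Dendriform dialgebra: $\Omega_D$ has basis $\{\prec,\succ\}$, $\star=\prec+\succ$ is the associative operation, and $\Lambda_D$ is spanned by $(\prec\otimes\prec,\prec\otimes\star)$, $(\succ\otimes\prec,\succ\otimes\prec)$, $(\star\otimes\succ,\succ\otimes\succ)$. Octo-algebra: eight generating operations $\nearrow_i,\nwarrow_i,\swarrow_i,\searrow_i$, $i=1,2$. For each $i=1,2$ put $\wedge_i=\nwarrow_i+\nearrow_i$, $\vee_i=\swarrow_i+\searrow_i$, $\prec_i=\nwarrow_i+\swarrow_i$, $\succ_i=\nearrow_i+\searrow_i$, $\star_i=\wedge_i+\vee_i$. For each symbol $a\in\{\nearrow,\nwarrow,\swarrow,\searrow,\wedge,\vee,\prec,\succ,\star\}$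 put $a_{12}=a_1+a_2$ (the operations $\prec_{12},\succ_{12},\star_{12}$ are also written $\ll,\gg,\bar\star$). The associative operation is $\bar\star=\star_{12}$, the sum of all eight generating operations. The 27 relations are: for each of the nine quadruples $(a,b;c,d)$ $(\nwarrow,\nwarrow;\nwarrow,\star)$, $(\nearrow,\nwarrow;\nearrow,\prec)$, $(\wedge,\nearrow;\nearrow,\succ)$, $(\swarrow,\nwarrow;\swarrow,\wedge)$, $(\searrow,\nwarrow;\searrow,\nwarrow)$, $(\vee,\nearrow;\searrow,\nearrow)$, $(\prec,\swarrow;\swarrow,\vee)$, $(\succ,\swarrow;\searrow,\swarrow)$, $(\star,\searrow;\searrow,\searrow)$, the three relations $$(x\,a_1\,y)\,b_1\,z=x\,c_1\,(y\,d_{12}\,z),\qquad (x\,a_2\,y)\,b_1\,z=x\,c_2\,(y\,d_1\,z),\qquad (x\,a_{12}\,y)\,b_2\,z=x\,c_2\,(y\,d_2\,z).$$ *)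

(* Defs.v *)
From HB Require Import structures.
From mathcomp Require Import all_boot all_order all_algebra.
From mathcomp Require Import ring.

Set Implicit Arguments.
Unset Strict Implicit.
Unset Printing Implicit Defensive.

Import GRing.Theory.
Local Open Scope ring_scope.

(* Tensor products of finite-dimensional spaces. MathComp has none, so V ⊗ W  *)
(* is modelled by coordinates: a tensor is the matrix of its coefficients on  *)
(* the products of the vectors of the standard bases of V and W. The lemmas   *)
(* tlift_tens and tens_gen below are the universal property.                  *)
Section Tensor.
Variable k : fieldType.

Definition tensor (V W : vectType k) : vectType k :=
  'M[k]_(\dim {:V}, \dim {:W}).

Definition vb (V : vectType k) (i : 'I_(\dim {:V})) : V := (vbasis {:V})`_i.
Definition vc (V : vectType k) (i : 'I_(\dim {:V})) (v : V) : k :=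
  coord (vbasis {:V}) i v.
Definition tc (V W : vectType k) (t : tensor V W) i j : k :=
  (t : 'M[k]_(\dim {:V}, \dim {:W})) i j.

Definition tens (V W : vectType k) (v : V) (w : W) : tensor V W :=
  \matrix_(i, j) (vc i v * vc j w).

Definition bilinear_fun (V W U : vectType k) (beta : V -> W -> U) : Prop :=
  (forall v, linear (beta v)) /\ (forall w, linear (beta^~ w)).

(* The linear map V ⊗ W -> U induced by a bilinear map beta.                  *)
Definition tlift (V W U : vectType k) (beta : V -> W -> U) (t : tensor V W)
  : U := \sum_i \sum_j tc t i j *: beta (vb i) (vb j).

Fact tlift_is_linear (V W U : vectType k) (beta : V -> W -> U) :
  linear (tlift beta).
Proof.
move=> a s t; rewrite /tlift scaler_sumr -big_split; apply: eq_bigr => i _.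
rewrite scaler_sumr -big_split; apply: eq_bigr => j _ /=.
by rewrite /tc !mxE scalerDl scalerA.
Qed.

HB.instance Definition _ (V W U : vectType k) (beta : V -> W -> U) :=
  GRing.isLinear.Build k (tensor V W) U _ (tlift beta) (tlift_is_linear beta).

Lemma tens_bilinear (V W : vectType k) : bilinear_fun (@tens V W).
Proof.
split=> [v | w] a x y; apply/matrixP=> i j; rewrite !mxE /vc linearP /=; ring.
Qed.

Lemma vb_sum (V : vectType k) (v : V) : v = \sum_i vc i v *: vb i.
Proof. exact/coord_vbasis/memvf. Qed.

Lemma vc_vb (V : vectType k) (i j : 'I_(\dim {:V})) :
  vc i (vb j) = (i == j)%:R.
Proof.
by rewrite /vc /vb coord_free ?(basis_free (vbasisP _)) // eq_sym.
Qed.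

Lemma tlift_tens (V W U : vectType k) (beta : V -> W -> U) v w :
  bilinear_fun beta -> tlift beta (tens v w) = beta v w.
Proof.
move=> [lr ll].
pose fr v := GRing.isLinear.Build k W U _ (beta v) (lr v).
pose gr v : {linear W -> U} := HB.pack (beta v) (fr v).
pose fl w := GRing.isLinear.Build k V U _ (beta^~ w) (ll w).
pose gl w : {linear V -> U} := HB.pack (beta^~ w) (fl w).
have -> : beta v w = gl w v by [].
rewrite [v in RHS]vb_sum linear_sum; apply: eq_bigr => i _.
rewrite linearZ /= -[beta _ w]/(gr (vb i) w) [w in RHS]vb_sum linear_sum.
rewrite scaler_sumr; apply: eq_bigr => j _.
by rewrite linearZ /= /tc mxE scalerA.
Qed.

Lemma tens_gen (V W : vectType k) (t : tensor V W) :
  t = \sum_i \sum_j tc t i j *: tens (vb i) (vb j).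
Proof.
rewrite [LHS](@matrix_sum_delta k (\dim {:V}) (\dim {:W})).
apply: eq_bigr => i _; apply: eq_bigr => j _; congr (_ *: _).
by apply/matrixP=> a b; rewrite !mxE !vc_vb -natrM mulnb.
Qed.

Definition tens_map (V W : vectType k) (f : V -> W) :
  tensor V V -> tensor W W := tlift (fun x y => tens (f x) (f y)).

(* sigma : (V ⊗ V) ⊗ (W ⊗ W) -> (V ⊗ W) ⊗ (V ⊗ W) exchanges the two middle    *)
(* factors.                                                                   *)
Definition sigma (V W : vectType k) :
  tensor (tensor V V) (tensor W W) -> tensor (tensor V W) (tensor V W) :=
  tlift (fun s t =>
    tlift (fun a b =>
      tlift (fun c d => tens (tens a c) (tens b d)) t) s).

Lemma tens_bilinear_l (V W : vectType k) (w : W) : linear (@tens V W ^~ w).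
Proof. exact: (tens_bilinear V W).2. Qed.

Lemma tens_bilinear_r (V W : vectType k) (v : V) : linear (@tens V W v).
Proof. exact: (tens_bilinear V W).1. Qed.

Lemma tlift_ext (V W U : vectType k) (b1 b2 : V -> W -> U) t :
  (forall v w, b1 v w = b2 v w) -> tlift b1 t = tlift b2 t.
Proof.
by move=> e; apply: eq_bigr => i _; apply: eq_bigr => j _; rewrite e.
Qed.

Lemma tlift_lincomb (V W U : vectType k) (b1 b2 : V -> W -> U) a t :
  tlift (fun v w => a *: b1 v w + b2 v w) t = a *: tlift b1 t + tlift b2 t.
Proof.
rewrite /tlift scaler_sumr -big_split; apply: eq_bigr => i _.
rewrite scaler_sumr -big_split; apply: eq_bigr => j _ /=.
by rewrite scalerDr !scalerA mulrC.
Qed.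

Lemma sigma_tens (V W : vectType k) (a b : V) (c d : W) :
  sigma (tens (tens a b) (tens c d)) = tens (tens a c) (tens b d).
Proof.
rewrite /sigma tlift_tens; last first.
  split=> [s | t] x u v; last exact: linearP.
  rewrite -tlift_lincomb; apply: tlift_ext => p q; exact: linearP.
rewrite tlift_tens; last first.
  split=> [p | q] x u v; rewrite -tlift_lincomb; apply: tlift_ext => r s.
    by rewrite tens_bilinear_l tens_bilinear_r.
  by rewrite !tens_bilinear_l.
rewrite tlift_tens //; split=> [p | q] x u v.
  by rewrite !tens_bilinear_r.
by rewrite tens_bilinear_r tens_bilinear_l.
Qed.

End Tensor.

Section ABQR.
Variable k : fieldType.

Definition rel_space (V : vectType k) : vectType k :=
  (tensor V V * tensor V V)%type.

(* (x a y) b z = x c (y d z)                                                  *)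
Definition relation (V : vectType k) (a b c d : V) : rel_space V :=
  (tens a b, tens c d).

Lemma rel_ext (V : vectType k) (r s : rel_space V) :
  (forall i j, tc r.1 i j = tc s.1 i j) ->
  (forall i j, tc r.2 i j = tc s.2 i j) -> r = s.
Proof.
case: r s => [r1 r2] [s1 s2] /= e1 e2.
by congr (_, _); apply/matrixP=> i j; [apply: e1 | apply: e2].
Qed.

Lemma tc_tens (V W : vectType k) (v : V) (w : W) i j :
  tc (tens v w) i j = vc i v * vc j w.
Proof. by rewrite [LHS]mxE. Qed.

Lemma tc_relD (V : vectType k) (r s : rel_space V) i j :
  (tc (r + s).1 i j = tc r.1 i j + tc s.1 i j) *
  (tc (r + s).2 i j = tc r.2 i j + tc s.2 i j).
Proof. by split; rewrite [LHS]mxE. Qed.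

Lemma tc_rel0 (V : vectType k) i j :
  (tc (0 : rel_space V).1 i j = 0) * (tc (0 : rel_space V).2 i j = 0).
Proof. by do ![split]; rewrite [LHS]mxE. Qed.

Lemma vcD (V : vectType k) i (v w : V) : vc i (v + w) = vc i v + vc i w.
Proof. exact: linearD. Qed.

Record abqr := ABQR {
  ops : vectType k;
  rels : {vspace rel_space ops};
  star : ops;
  star_assoc : relation star star star star \in rels
}.

Definition rel_map (V W : vectType k) (f : V -> W) (r : rel_space V)
  : rel_space W := (tens_map f r.1, tens_map f r.2).

Fact rel_map_is_linear (V W : vectType k) (f : V -> W) : linear (rel_map f).
Proof. by move=> a r s; rewrite /rel_map /tens_map !linearP. Qed.

HB.instance Definition _ (V W : vectType k) (f : V -> W) :=
  GRing.isLinear.Build k (rel_space V) (rel_space W) _ (rel_map f)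
    (rel_map_is_linear f).

Definition abqr_isomorphic (P Q : abqr) : Prop :=
  exists f : 'Hom(ops P, ops Q),
    [/\ bijective f,
        f (star P) = star Q &
        (linfun (rel_map f) @: rels P)%VS = rels Q].

Definition square_rel (V W : vectType k) (f1 : rel_space V) (f2 : rel_space W)
  : rel_space (tensor V W) :=
  (sigma (tens f1.1 f2.1), sigma (tens f1.2 f2.2)).

(* By bilinearity it is enough to let f1 and f2 run over bases, as for the    *)
(* product of subspaces prodv of falgebra; see square_relsP.                  *)
Definition square_rels (V W : vectType k) (L1 : {vspace rel_space V})
  (L2 : {vspace rel_space W}) : {vspace rel_space (tensor V W)} :=
  <<[seq square_rel f1 f2 | f1 <- vbasis L1, f2 <- vbasis L2]>>%VS.

Lemma square_rel_l (V W : vectType k) (f2 : rel_space W) :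
  linear (@square_rel V W ^~ f2).
Proof.
by move=> a x y; rewrite /square_rel /sigma !tens_bilinear_l !linearP.
Qed.

Lemma square_rel_r (V W : vectType k) (f1 : rel_space V) :
  linear (@square_rel V W f1).
Proof.
by move=> a x y; rewrite /square_rel /sigma !tens_bilinear_r !linearP.
Qed.

Lemma square_relsP (V W : vectType k) (L1 : {vspace rel_space V})
    (L2 : {vspace rel_space W}) (M : {vspace rel_space (tensor V W)}) :
  reflect (forall f1 f2, f1 \in L1 -> f2 \in L2 -> square_rel f1 f2 \in M)
          (square_rels L1 L2 <= M)%VS.
Proof.
apply: (iffP idP) => [/span_subvP sM f1 f2 Lf1 Lf2 | sM]; last first.
  apply/span_subvP=> _ /allpairsP[[x y] /= [xL yL ->]].
  by apply: sM; apply: vbasis_mem.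
pose fl f2 := GRing.isLinear.Build k _ _ _ _ (@square_rel_l V W f2).
pose gl f2 : {linear rel_space V -> rel_space (tensor V W)} :=
  HB.pack (@square_rel V W ^~ f2) (fl f2).
pose fr f1 := GRing.isLinear.Build k _ _ _ _ (@square_rel_r V W f1).
pose gr f1 : {linear rel_space W -> rel_space (tensor V W)} :=
  HB.pack (@square_rel V W f1) (fr f1).
rewrite -[square_rel _ _]/(gl f2 f1) (coord_vbasis Lf1) linear_sum.
apply: rpred_sum => i _; rewrite linearZ; apply: rpredZ.
rewrite /= -[square_rel _ _]/(gr (vbasis L1)`_i f2) (coord_vbasis Lf2).
rewrite linear_sum; apply: rpred_sum => j _; rewrite linearZ; apply: rpredZ.
by apply: sM; apply/allpairs_f; apply: mem_nth; rewrite size_tuple.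
Qed.

Fact square_assoc (P Q : abqr) (s := tens (star P) (star Q)) :
  relation s s s s \in square_rels (rels P) (rels Q).
Proof.
have /square_relsP/(_ _ _ (star_assoc P) (star_assoc Q)) := subvv
  (square_rels (rels P) (rels Q)).
by rewrite /square_rel /= !sigma_tens.
Qed.

Definition square (P Q : abqr) : abqr := ABQR (square_assoc P Q).

Definition free_ops (S : finType) : vectType k := {ffun S -> k^o}.

Definition sym (S : finType) (s : S) : free_ops S := [ffun t => (t == s)%:R].

Lemma sum_mem_span (V : vectType k) (X : seq V) :
  \sum_(x <- X) x \in <<X>>%VS.
Proof. by rewrite big_seq; apply: rpred_sum => x; apply: memv_span. Qed.

End ABQR.

Inductive dend_sym := Prec | Succ.

Definition dend_code (s : dend_sym) : bool := if s is Prec then true else false.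
Definition dend_decode (b : bool) : dend_sym := if b then Prec else Succ.
Lemma dend_codeK : cancel dend_code dend_decode. Proof. by case. Qed.
HB.instance Definition _ := Finite.copy dend_sym (can_type dend_codeK).

Section Dendriform.
Variable k : fieldType.

Definition dprec : free_ops k dend_sym := sym k Prec.
Definition dsucc : free_ops k dend_sym := sym k Succ.
Definition dstar := dprec + dsucc.

Definition dend_rels : seq (rel_space (free_ops k dend_sym)) :=
  [:: relation dprec dprec dprec dstar;
      relation dsucc dprec dsucc dprec;
      relation dstar dsucc dsucc dsucc].

Fact dend_assoc :
  relation dstar dstar dstar dstar \in <<dend_rels>>%VS.
Proof.
have -> : relation dstar dstar dstar dstar = \sum_(r <- dend_rels) r.
  rewrite !big_cons big_nil; apply: rel_ext => i j;
    rewrite !tc_relD !tc_rel0 !tc_tens /dstar !vcD; ring.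
exact: sum_mem_span.
Qed.

Definition dendriform : abqr k := ABQR dend_assoc.

End Dendriform.

Inductive arrow := NE | NW | SW | SE.

Definition arrow_code (a : arrow) : bool * bool :=
  match a with
  | NE => (true, true) | NW => (true, false)
  | SW => (false, false) | SE => (false, true)
  end.
Definition arrow_decode (b : bool * bool) : arrow :=
  match b with
  | (true, true) => NE | (true, false) => NW
  | (false, false) => SW | (false, true) => SE
  end.
Lemma arrow_codeK : cancel arrow_code arrow_decode. Proof. by case. Qed.
HB.instance Definition _ := Finite.copy arrow (can_type arrow_codeK).

Inductive level := One | Two.

Definition level_code (l : level) : bool := if l is One then true else false.
Definition level_decode (b : bool) : level := if b then One else Two.
Lemma level_codeK : cancel level_code level_decode. Proof. by case. Qed.
HB.instance Definition _ := Finite.copy level (can_type level_codeK).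

Section Octo.
Variable k : fieldType.

Definition octo_ops : vectType k := free_ops k (arrow * level)%type.

(* Each of the nine symbols a is the family i |-> a_i.                        *)
Definition arr (a : arrow) (i : level) : octo_ops := sym k (a, i).
Local Notation nw := (arr NW).
Local Notation ne := (arr NE).
Local Notation sw := (arr SW).
Local Notation se := (arr SE).
Definition wedge i := nw i + ne i.
Definition vee i := sw i + se i.
Definition prec i := nw i + sw i.
Definition succ i := ne i + se i.
Definition ostar i := wedge i + vee i.

Definition both (a : level -> octo_ops) : octo_ops := a One + a Two.

Definition octo_quads :
  seq ((level -> octo_ops) * (level -> octo_ops) * (level -> octo_ops)
       * (level -> octo_ops)) :=
  [:: (nw,    nw, nw, ostar);
      (ne,    nw, ne, prec);
      (wedge, ne, ne, succ);
      (sw,    nw, sw, wedge);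
      (se,    nw, se, nw);
      (vee,   ne, se, ne);
      (prec,  sw, sw, vee);
      (succ,  sw, se, sw);
      (ostar, se, se, se)].

Definition octo_rels : seq (rel_space octo_ops) :=
  flatten [seq let: (a, b, c, d) := q in
    [:: relation (a One) (b One) (c One) (both d);
        relation (a Two) (b One) (c Two) (d One);
        relation (both a) (b Two) (c Two) (d Two)] | q <- octo_quads].

Definition bstar := both ostar.

Fact octo_assoc : relation bstar bstar bstar bstar \in <<octo_rels>>%VS.
Proof.
have -> : relation bstar bstar bstar bstar = \sum_(r <- octo_rels) r.
  rewrite /octo_rels /octo_quads /= !big_cons big_nil.
  rewrite /bstar /both /ostar /wedge /vee /prec /succ.
  move: (arr NE) (arr NW) (arr SW) (arr SE) => ne nw sw se.
  apply: rel_ext => i j;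
    rewrite !tc_relD !tc_rel0 !tc_tens !vcD; ring.
exact: sum_mem_span.
Qed.

Definition octo : abqr k := ABQR octo_assoc.

End Octo.

(* Main.v *)
From HB Require Import structures.
Require Import Defs.
From mathcomp Require Import all_boot all_order all_algebra.

(** Both the arrows and the levels are pairs of dendriform symbols in disguise:
    [N, S] and [W, E] stand for [≺, ≻] in a vertical and a horizontal factor,
    and levels [1, 2] for [≺, ≻] in a third factor. Sending [a_i] to
    vertical ⊗ horizontal ⊗ level, a sum over both values of a coordinate
    goes to the operation [⋆] in that factor, and each octo-algebra relation
    goes to the square product of three dendriform relations. *)

Set Implicit Arguments.
Unset Strict Implicit.
Unset Printing Implicit Defensive.

Import GRing.Theory.
Local Open Scope ring_scope.

Section Bilinear.
Variable k : fieldType.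

(** With one argument fixed, the preimage of [M] is a subspace, so it contains a span as soon as it
    contains the generators. This is applied to [Y] first, then to [X]. *)
Lemma bilinear_span_mem (V W U : vectType k) (beta : V -> W -> U)
    (X : seq V) (Y : seq W) (M : {vspace U}) v w :
  bilinear_fun beta ->
  (forall x y, x \in X -> y \in Y -> beta x y \in M) ->
  v \in <<X>>%VS -> w \in <<Y>>%VS -> beta v w \in M.
Proof.
move=> [lr ll] XYM.
pose fr v := GRing.isLinear.Build k W U _ (beta v) (lr v).
pose gr v : {linear W -> U} := HB.pack (beta v) (fr v).
pose fl w := GRing.isLinear.Build k V U _ (beta^~ w) (ll w).
pose gl w : {linear V -> U} := HB.pack (beta^~ w) (fl w).
move=> Xv Yw.
have XM x : x \in X -> beta x w \in M.
  move=> Xx; have /span_subvP/subvP/(_ w Yw) : {subset Y <= linfun (gr x) @^-1: M}%VS.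
    by move=> y Yy; rewrite -memv_preim lfunE XYM.
  by rewrite -memv_preim lfunE.
have /span_subvP/subvP/(_ v Xv) : {subset X <= linfun (gl w) @^-1: M}%VS.
  by move=> x Xx; rewrite -memv_preim lfunE; apply: XM.
by rewrite -memv_preim lfunE.
Qed.

Lemma span_tens_full (V W : vectType k) (X : seq V) (Y : seq W) :
  <<X>>%VS = fullv -> <<Y>>%VS = fullv ->
  <<[seq tens x y | x <- X, y <- Y]>>%VS = fullv.
Proof.
move=> fX fY; apply/eqP; rewrite eqEsubv subvf andTb; apply/subvP=> t _; rewrite (tens_gen t).
apply: rpred_sum => i _; apply: rpred_sum => j _; apply: rpredZ.
apply: (bilinear_span_mem (tens_bilinear V W) (X := X) (Y := Y)).
- by move=> x y Xx Yy; apply/memv_span/allpairs_f.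
- by rewrite fX memvf.
- by rewrite fY memvf.
Qed.

(** [square_rels] is defined through the abstract bases [vbasis]; this replaces them by explicit
    generators such as [dend_rels]. *)
Lemma square_rels_span (V W : vectType k) (X : seq (rel_space V))
    (Y : seq (rel_space W)) :
  square_rels <<X>> <<Y>> = <<[seq square_rel f g | f <- X, g <- Y]>>%VS.
Proof.
apply/eqP; rewrite eqEsubv; apply/andP; split.
  apply/square_relsP=> f g; apply: bilinear_span_mem.
    by split=> ?; [apply: square_rel_r | apply: square_rel_l].
  by move=> x y Xx Yy; apply/memv_span/allpairs_f.
apply/span_subvP=> _ /allpairsP[[f g] /= [Xf Yg ->]].
(* The trivial inclusion of [square_rels] in itself says that it contains the square product of any
   two relations, not only of basis vectors. *)
have /square_relsP := subvv (square_rels <<X>> <<Y>>).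
by apply; apply: memv_span.
Qed.

Lemma square_rel_relation (V W : vectType k) (a b c d : V) (a' b' c' d' : W) :
  square_rel (relation a b c d) (relation a' b' c' d') =
  relation (tens a a') (tens b b') (tens c c') (tens d d').
Proof. by rewrite /square_rel /= !sigma_tens. Qed.

Lemma rel_map_relation (V W : vectType k) (f : {linear V -> W}) a b c d :
  rel_map f (relation a b c d) = relation (f a) (f b) (f c) (f d).
Proof.
have bf : bilinear_fun (fun x y => tens (f x) (f y)).
  by split=> ? ? ? ?; rewrite linearP ?tens_bilinear_l ?tens_bilinear_r.
by rewrite /rel_map /tens_map /= !tlift_tens.
Qed.

Lemma tensDl (V W : vectType k) (v v' : V) (w : W) :
  tens (v + v') w = tens v w + tens v' w.
Proof. by have := tens_bilinear_l w 1 v v'; rewrite !scale1r. Qed.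

Lemma tensDr (V W : vectType k) (v : V) (w w' : W) :
  tens v (w + w') = tens v w + tens v w'.
Proof. by have := tens_bilinear_r v 1 w w'; rewrite !scale1r. Qed.

Lemma dim_tensor (V W : vectType k) :
  \dim {:tensor V W} = (\dim {:V} * \dim {:W})%N.
Proof. by rewrite dimvf dim_matrix. Qed.

Lemma dim_free_ops (S : finType) : \dim {:free_ops k S} = #|S|.
(* The dimension of a function space unfolds to [#|S|] times the dimension 1 of [k^o]. *)
Proof. by rewrite dimvf; apply: muln1. Qed.

Lemma free_ops_sum (S : finType) (v : free_ops k S) :
  v = \sum_s v s *: sym k s.
Proof.
apply/ffunP=> t; rewrite sum_ffunE (bigD1 t) //= !ffunE eqxx.
rewrite big1 ?addr0 => [|s nst]; first by rewrite [RHS]mulr1.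
by rewrite !ffunE eq_sym (negbTE nst) [LHS]mulr0.
Qed.

Definition free_lift (S : finType) (U : vectType k) (F : S -> U)
  (v : free_ops k S) : U := \sum_s v s *: F s.

Fact free_lift_is_linear (S : finType) (U : vectType k) (F : S -> U) :
  linear (free_lift F).
Proof.
move=> a v w; rewrite /free_lift scaler_sumr -big_split; apply: eq_bigr => s _.
by rewrite !ffunE scalerDl scalerA.
Qed.

HB.instance Definition _ (S : finType) (U : vectType k) (F : S -> U) :=
  GRing.isLinear.Build k (free_ops k S) U _ (free_lift F)
    (free_lift_is_linear F).

Lemma free_lift_sym (S : finType) (U : vectType k) (F : S -> U) s :
  free_lift F (sym k s) = F s.
Proof.
rewrite /free_lift (bigD1 s) //= ffunE eqxx scale1r big1 ?addr0 // => t nts.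
by rewrite ffunE (negbTE nts) scale0r.
Qed.

(** By rank-nullity the kernel has dimension zero. Surjectivity is the convenient half to check,
    since it suffices to reach a spanning family. *)
Lemma surj_dim_bijective (V W : vectType k) (f : 'Hom(V, W)) :
  limg f = fullv -> \dim {:V} = \dim {:W} -> bijective f.
Proof.
move=> fT dVW; have fK : lker f == 0%VS.
  have := limg_ker_dim f fullv.
  by rewrite fT -dVW capfv -[RHS]add0n => /addIn/eqP; rewrite dimv_eq0.
exists (f^-1)%VF; first exact: lker0_lfunK.
by move=> w; rewrite limg_lfunVK ?fT ?memvf.
Qed.

End Bilinear.

Lemma card_dend_sym : #|{: dend_sym}| = 2%N.
Proof.
rewrite -card_bool; apply: (@bij_eq_card _ _ dend_code).
by exists dend_decode; case.
Qed.

Lemma card_octo : #|{: arrow * level}| = 8%N.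
Proof.
have cA : #|{: arrow}| = #|{: bool * bool}|.
  by apply: (@bij_eq_card _ _ arrow_code); exists arrow_decode; [case | case=> -[] []].
have cL : #|{: level}| = #|{: bool}|.
  by apply: (@bij_eq_card _ _ level_code); exists level_decode; case.
by rewrite card_prod cA cL card_prod card_bool.
Qed.

Lemma span_dend (k : fieldType) :
  <<[:: dprec k; dsucc k]>>%VS = {: free_ops k dend_sym}%VS.
Proof.
apply/eqP; rewrite eqEsubv subvf andTb; apply/subvP=> v _; rewrite (free_ops_sum v).
by apply: rpred_sum => -[] _; apply/rpredZ/memv_span; rewrite !inE eqxx ?orbT.
Qed.

Section OctoCube.
Variable k : fieldType.
Local Notation p := (dprec k).
Local Notation s := (dsucc k).
Local Notation cube := (square (square (dendriform k) (dendriform k)) (dendriform k)).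

Definition vertical (a : arrow) := match a with NW | NE => p | SW | SE => s end.
Definition horizontal (a : arrow) := match a with NW | SW => p | NE | SE => s end.
Definition depth (i : level) := match i with One => p | Two => s end.

Definition cube_sym (u : arrow * level) : ops cube :=
  tens (tens (vertical u.1) (horizontal u.1)) (depth u.2).

Definition octo_cube : 'Hom(ops (octo k), ops cube) :=
  linfun (free_lift cube_sym).

Lemma octo_cube_arr a i :
  octo_cube (arr k a i) = tens (tens (vertical a) (horizontal a)) (depth i).
Proof. by rewrite lfunE /= free_lift_sym. Qed.

(** Only the last factor depends on the level, so bilinearity collects [p + s] there. *)
Lemma octo_cube_both (a : level -> octo_ops k) (t : tensor _ _) :
  (forall i, octo_cube (a i) = tens t (depth i)) ->
  octo_cube (both a) = tens t (dstar k).
Proof. by move=> at_; rewrite linearD /= !at_ tensDr. Qed.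

(** [wedge] and [vee] sum over the horizontal coordinate, so [dstar] appears in the second factor;
    [prec] and [succ] sum over the vertical one, so it appears in the first. *)
Lemma octo_cube_wedge i :
  octo_cube (wedge k i) = tens (tens p (dstar k)) (depth i).
Proof. by rewrite linearD /= !octo_cube_arr tensDr tensDl. Qed.

Lemma octo_cube_vee i :
  octo_cube (vee k i) = tens (tens s (dstar k)) (depth i).
Proof. by rewrite linearD /= !octo_cube_arr tensDr tensDl. Qed.

Lemma octo_cube_prec i :
  octo_cube (prec k i) = tens (tens (dstar k) p) (depth i).
Proof. by rewrite linearD /= !octo_cube_arr !tensDl. Qed.

Lemma octo_cube_succ i :
  octo_cube (succ k i) = tens (tens (dstar k) s) (depth i).
Proof. by rewrite linearD /= !octo_cube_arr !tensDl. Qed.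

Lemma octo_cube_ostar i :
  octo_cube (ostar k i) = tens (tens (dstar k) (dstar k)) (depth i).
Proof. by rewrite linearD /= octo_cube_wedge octo_cube_vee !tensDl. Qed.

Definition octo_cubeE := (octo_cube_wedge, octo_cube_vee, octo_cube_prec,
  octo_cube_succ, octo_cube_ostar, octo_cube_arr).

(** The level patterns (1,1;1,12), (2,1;2,1), (12,2;2,2) are the three dendriform relations, in the
    order of [dend_rels]. A quadruple thus fixes the relations in the first two factors while the
    third runs through the list. *)
Lemma octo_cube_quad (a b c d : level -> octo_ops k)
    (a1 b1 c1 d1 a2 b2 c2 d2 : free_ops k dend_sym) :
  (forall i, octo_cube (a i) = tens (tens a1 a2) (depth i)) ->
  (forall i, octo_cube (b i) = tens (tens b1 b2) (depth i)) ->
  (forall i, octo_cube (c i) = tens (tens c1 c2) (depth i)) ->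
  (forall i, octo_cube (d i) = tens (tens d1 d2) (depth i)) ->
  [seq linfun (rel_map octo_cube) r | r <-
    [:: relation (a One) (b One) (c One) (both d);
        relation (a Two) (b One) (c Two) (d One);
        relation (both a) (b Two) (c Two) (d Two)]] =
  [seq square_rel
         (square_rel (relation a1 b1 c1 d1) (relation a2 b2 c2 d2)) g
  | g <- dend_rels k].
Proof.
move=> aE bE cE dE.
have aE2 := octo_cube_both aE; have dE2 := octo_cube_both dE.
rewrite /= !square_rel_relation.
by congr [:: _; _; _]; rewrite lfunE /= rel_map_relation /= ?aE2 ?dE2 ?aE ?bE ?cE ?dE.
Qed.

Lemma octo_cube_bijective : bijective octo_cube.
Proof.
apply: surj_dim_bijective; last first.
  by rewrite !dim_tensor !dim_free_ops card_dend_sym card_octo.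
apply/eqP; rewrite eqEsubv subvf andTb.
(* The target becomes the span of eight pure tensors, each the image of one generating operation. *)
rewrite -(span_tens_full (span_tens_full (span_dend k) (span_dend k)) (span_dend k)).
have im a i : tens (tens (vertical a) (horizontal a)) (depth i) \in limg octo_cube.
  by rewrite -octo_cube_arr memv_img ?memvf.
apply/span_subvP=> _ /allpairsP[[u z] [/allpairsP[[x y] [xP yP uE]] zP ->]].
rewrite {}uE /=; move: xP yP zP; rewrite !inE /=.
move=> /orP[]/eqP-> /orP[]/eqP-> /orP[]/eqP->.
- exact: (im NW One).
- exact: (im NW Two).
- exact: (im NE One).
- exact: (im NE Two).
- exact: (im SW One).
- exact: (im SW Two).
- exact: (im SE One).
- exact: (im SE Two).
Qed.

(** Both sides are spans of explicit lists of 27 relations that agree term by term, so equality of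
    lists gives both inclusions at once. *)
Lemma octo_cube_rels :
  (linfun (rel_map octo_cube) @: rels (octo k))%VS = rels cube.
Proof.
rewrite limg_span.
rewrite [RHS](_ : _ = <<[seq square_rel f g | f <- [seq square_rel f g
  | f <- dend_rels k, g <- dend_rels k], g <- dend_rels k]>>%VS); last first.
  by rewrite -square_rels_span -square_rels_span.
congr (<<_>>)%VS; rewrite /octo_rels [LHS]map_flatten -map_comp.
(* The outer [allpairs] is by definition a flattened list, so both sides are concatenations of nine
   blocks of three relations. *)
congr flatten.
(* With the vertical factor first, [octo_quads] enumerates the pairs of
   dendriform relations in the order of [allpairs]. *)
do 9 (apply: (congr2 cons _ _); first by apply: octo_cube_quad => i; rewrite octo_cubeE).
by [].
Qed.

End OctoCube.

Theorem proposition3p8 (k : fieldType) (hchar : [pchar k]%R =i pred0) :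
  abqr_isomorphic (octo k)
    (square (square (dendriform k) (dendriform k)) (dendriform k)).
Proof.
exists (octo_cube k); split.
- exact: octo_cube_bijective.
(* The associative operation [bstar] is [both] of [ostar], and its image is the tensor of three
   copies of [dstar]. *)
- exact: (octo_cube_both (octo_cube_ostar k)).
- exact: octo_cube_rels.
Qed.
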